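(* The categories $\mathbf{LSS}_0$, $\mathbf{LatBD}^{op}$ and $\mathbf{SpecBD}$ are equivalent.
   Context: Foundations: ZFC with a universe; objects of the categories are structures on sets of that universe. $\mathcal{P}(X)$ is the powerset of $X$. For families of sets, $\mathcal{U}\cap_1\mathcal{V}=\{U\cap V\mid U\in\mathcal{U},V\in\mathcal{V}\}$; for a set $Z$, $\mathcal{U}\cap_1 Z=\{U\cap Z\mid U\in\mathcal{U}\}$. For a family $\mathcal{L}\subseteq\mathcal{P}(X)$ put $\mathcal{L}^o=\{M\subseteq X\mid M\cap A\in\mathcal{L}\text{ for all }A\in\mathcal{L}\}$. The category $\mathbf{LSS}_0$. A locally small space is a pair $(X,\mathcal{L}_X)$ with $X$ a set and $\mathcal{L}_X\subseteq\mathcal{P}(X)$ such that $\emptyset\in\mathcal{L}_X$, $A,B\in\mathcal{L}_X$ implies $A\cap B,A\cup B\in\mathcal{L}_X$, and $\bigcup\mathcal{L}_X=X$. It is $T_0$ (Kolmogorov) if $\mathcal{L}_X$ separates points: whenever $x,y\in X$ satisfy ($x\in A\iff y\in A$) for all $A\in\mathcal{L}_X$, then $x=y$. A mapping $f:X\to Y$ between locally small spaces is bounded if for each $A\in\mathcal{L}_X$ there is $B\in\mathcal{L}_Y$ with $A\subseteq f^{-1}(B)$, and continuous if $f^{-1}(B)\cap A\in\mathcal{L}_X$ for all $B\in\mathcal{L}_Y$, $A\in\mathcal{L}_X$. $\mathbf{LSS}_0$ has the $T_0$ locally small spaces as objects and the bounded continuous mappings as morphisms. The category $\mathbf{SpecBD}$.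 For a topological space $X$, $CO(X)$ denotes the family of compact (not necessarily Hausdorff) open subsets. A spectral space is a $T_0$, sober topological space $X$ such that $X\in CO(X)$, $CO(X)$ is a basis of the topology, and $CO(X)$ is closed under binary intersections; sober means that every open $W\neq X$ either is of the form $W=V_1\cap V_2$ with $V_1,V_2$ open and $W\ne V_1$, $W\neq V_2$, or equals $X\setminus\overline{\{x\}}$ for some $x\in X$. A mapping $g:X\to Y$ between spectral spaces is spectral if $g^{-1}(B)\in CO(X)$ for all $B\in CO(Y)$. A bornology in a bounded lattice $(L,\vee,\wedge,0,1)$ is an ideal $B\subseteq L$ such that $\bigvee B=1$ (the supremum in $L$). An object of $\mathbf{SpecBD}$ is a system $((X,\tau_X),CO_s(X),X_d)$ where $(X,\tau_X)$ is a spectral space, $CO_s(X)$ is a bornology in the bounded lattice $CO(X)$ and $X_d\subseteq X$ (a decent lump of $X$) satisfies, with $CO(X)_d=\{A\cap X_d\mid A\in CO(X)\}$ and $CO_s(X)_d=\{A\cap X_d\mid A\in CO_s(X)\}$: (1) $X_d\subseteq\bigcup CO_s(X)$; (2) the map $CO(X)\ni A\mapsto A\cap X_d\in CO(X)_d$ is an isomorphism of lattices; (3) $CO(X)_d=(CO_s(X)_d)^o$, where $(\cdot)^o$ is formed in $\mathcal{P}(X_d)$. A morphism from $((X,\tau_X),CO_s(X),X_d)$ to $((Y,\tau_Y),CO_s(Y),Y_d)$ is a spectral mapping $g:X\to Y$ such that for each $A\in CO_s(X)$ there is $B\in CO_s(Y)$ with $g(A)\subseteq B$, and $g(X_d)\subseteq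 Y_d$. The category $\mathbf{LatBD}$. For a bounded distributive lattice $L$, $\mathcal{PF}(L)$ is the set of all (proper) prime filters of $L$; for $a\in L$, $\tilde a=\{F\in\mathcal{PF}(L)\mid a\in F\}$; $\widetilde{L}=\{\tilde a\mid a\in L\}$ and, for $L_s\subseteq L$, $\widetilde{L_s}=\{\tilde a\mid a\in L_s\}$. For a homomorphism of bounded lattices $h:L\to M$ and $G\in\mathcal{PF}(M)$, $h^{\bullet}(G)=\{a\in L\mid h(a)\in G\}\in\mathcal{PF}(L)$. An object of $\mathbf{LatBD}$ is a system $(L,L_s,\mathbf{D}_L)$ with $L$ a bounded distributive lattice, $L_s$ a bornology in $L$, and $\mathbf{D}_L$ (a decent lump of prime filters on $L$) satisfying: (1) $\mathbf{D}_L\subseteq\bigcup\widetilde{L_s}\subseteq\mathcal{PF}(L)$; (2) for all $a,b\in L$, $a\neq b$ implies $\tilde a\cap\mathbf{D}_L\neq\tilde b\cap\mathbf{D}_L$; (3) $\widetilde{L}\cap_1\mathbf{D}_L=(\widetilde{L_s}\cap_1\mathbf{D}_L)^o$, where $(\cdot)^o$ is formed in $\mathcal{P}(\mathbf{D}_L)$. A morphism from $(L,L_s,\mathbf{D}_L)$ to $(M,M_s,\mathbf{D}_M)$ is a homomorphism of bounded lattices $h:L\to M$ such that for each $a\in M_s$ there is $b\in L_s$ with $a\vee h(b)=h(b)$, and $h^{\bullet}(\mathbf{D}_M)\subseteq\mathbf{D}_L$. In all three categories composition is composition of mappings; $^{op}$ denotes the opposite category. *)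

(* Defs.v *)
From HB Require Import structures.
From mathcomp Require Import all_boot all_order.
From mathcomp Require Import all_classical.
From mathcomp Require Import topology.

Set Implicit Arguments.
Unset Strict Implicit.
Unset Printing Implicit Defensive.

Import Order.Theory.

Local Open Scope classical_set_scope.

Record category := Category {
  obj :> Type;
  hom : obj -> obj -> Type;
  idm : forall a, hom a a;
  compm : forall a b c, hom b c -> hom a b -> hom a c;
  comp1m : forall a b (f : hom a b), compm (idm b) f = f;
  compm1 : forall a b (f : hom a b), compm f (idm a) = f;
  compmA : forall a b c d (h : hom c d) (g : hom b c) (f : hom a b),
    compm h (compm g f) = compm (compm h g) f
}.
Arguments idm {c0} a.
Arguments compm {c0 a b c}.

Definition opposite (C : category) : category :=
  @Category C (fun a b => hom b a) (fun a => idm a)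
    (fun a b c g f => compm f g)
    (fun a b f => compm1 f) (fun a b f => comp1m f)
    (fun a b c d h g f => esym (compmA f g h)).

Record functor (C D : category) := Functor {
  fobj :> C -> D;
  fmap : forall a b : C, hom a b -> hom (fobj a) (fobj b);
  fmap1 : forall a : C, fmap (idm a) = idm (fobj a);
  fmapM : forall (a b c : C) (g : hom b c) (f : hom a b),
    fmap (compm g f) = compm (fmap g) (fmap f)
}.

Definition idF (C : category) : functor C C :=
  @Functor C C id (fun _ _ f => f) (fun=> erefl) (fun _ _ _ _ _ => erefl).

Lemma compF1 (C D E : category) (G : functor D E) (F : functor C D) (a : C) :
  fmap G (fmap F (idm a)) = idm (G (F a)).
Proof. by rewrite !fmap1. Qed.

Lemma compFM (C D E : category) (G : functor D E) (F : functor C D)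
    (a b c : C) (g : hom b c) (f : hom a b) :
  fmap G (fmap F (compm g f)) =
  compm (fmap G (fmap F g)) (fmap G (fmap F f)).
Proof. by rewrite !fmapM. Qed.

Definition compF (C D E : category) (G : functor D E) (F : functor C D) :
    functor C E :=
  @Functor C E (fun a => G (F a)) (fun _ _ f => fmap G (fmap F f))
    (@compF1 C D E G F) (@compFM C D E G F).

Definition isomorphism (C : category) (a b : C) (f : hom a b) : Prop :=
  exists g : hom b a, compm g f = idm a /\ compm f g = idm b.

Definition naturally_isomorphic (C D : category) (F G : functor C D) : Prop :=
  exists eta : forall a : C, hom (F a) (G a),
    (forall (a b : C) (f : hom a b),
       compm (eta b) (fmap F f) = compm (fmap G f) (eta a)) /\
    (forall a : C, isomorphism (eta a)).

Definition equivalent (C D : category) : Prop :=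
  exists (F : functor C D) (G : functor D C),
    naturally_isomorphic (compF G F) (idF C) /\
    naturally_isomorphic (compF F G) (idF D).

(** The category of the structures [O] with carrier [U], whose morphisms are
    the mappings of carriers satisfying [P], composed as mappings. *)
Section ConcreteCategory.
Variables (O : Type) (U : O -> Type).
Variable P : forall X Y : O, (U X -> U Y) -> Prop.
Hypothesis P1 : forall X : O, P (@idfun (U X)).
Hypothesis PM : forall (X Y Z : O) (g : U Y -> U Z) (f : U X -> U Y),
  P g -> P f -> P (g \o f).

Let chom (X Y : O) : Type := {f : U X -> U Y | P f}.
Let cid (X : O) : chom X X := exist _ idfun (P1 X).
Let ccomp (X Y Z : O) (g : chom Y Z) (f : chom X Y) : chom X Z :=
  exist _ (sval g \o sval f) (PM (svalP g) (svalP f)).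

Let ccomp1m X Y (f : chom X Y) : ccomp (cid Y) f = f.
Proof. by case: f => f Pf; apply: eq_exist. Qed.
Let ccompm1 X Y (f : chom X Y) : ccomp f (cid X) = f.
Proof. by case: f => f Pf; apply: eq_exist. Qed.
Let ccompmA X Y Z T (h : chom Z T) (g : chom Y Z) (f : chom X Y) :
  ccomp h (ccomp g f) = ccomp (ccomp h g) f.
Proof. exact: eq_exist. Qed.

Definition concrete_category : category :=
  @Category O chom cid ccomp ccomp1m ccompm1 ccompmA.
End ConcreteCategory.

Definition trace_family (T : Type) (U : set (set T)) (Z : set T) :
    set (set T) :=
  [set A `&` Z | A in U].

(** [L^o] for a family [L] of subsets of [Z], formed in the powerset of [Z]. *)
Definition family_o (T : Type) (Z : set T) (L : set (set T)) : set (set T) :=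
  [set M | M `<=` Z /\ forall A, L A -> L (M `&` A)].

Record lss0 := Lss0 {
  lss_carrier :> Type;
  smops : set (set lss_carrier);
  smops0 : smops set0;
  smopsI : forall A B, smops A -> smops B -> smops (A `&` B);
  smopsU : forall A B, smops A -> smops B -> smops (A `|` B);
  smops_cover : \bigcup_(A in smops) A = setT;
  smops_T0 : forall x y : lss_carrier,
    (forall A, smops A -> (A x <-> A y)) -> x = y
}.
Arguments smops : clear implicits.

Definition lss_bounded (X Y : lss0) (f : X -> Y) : Prop :=
  forall A, smops X A -> exists2 B, smops Y B & A `<=` f @^-1` B.

Definition lss_continuous (X Y : lss0) (f : X -> Y) : Prop :=
  forall B A, smops Y B -> smops X A -> smops X (f @^-1` B `&` A).

Definition lss_morphism (X Y : lss0) (f : X -> Y) : Prop :=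
  lss_bounded f /\ lss_continuous f.

Lemma lss_morphism_id (X : lss0) : lss_morphism (@idfun X).
Proof.
split=> [A XA|B A XB XA]; first by exists A.
exact: smopsI.
Qed.

Lemma lss_morphism_comp (X Y Z : lss0) (g : Y -> Z) (f : X -> Y) :
  lss_morphism g -> lss_morphism f -> lss_morphism (g \o f).
Proof.
move=> [gb gc] [fb fc]; split=> [A XA|C A ZC XA].
  have [B YB AB] := fb A XA; have [C ZC BC] := gb B YB.
  by exists C => // x Ax; apply/BC/AB.
have [B YB AB] := fb A XA.
suff -> : (g \o f) @^-1` C `&` A = f @^-1` (g @^-1` C `&` B) `&` A.
  by apply: fc => //; apply: gc.
by apply/seteqP; split=> x /= [Cx Ax]; split=> //; [split=> //; apply: AB|case: Cx].
Qed.

Definition LSS0 : category :=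
  concrete_category lss_morphism_id lss_morphism_comp.

Section Lattices.
Context (d : Order.disp_t).

Definition lattice_ideal (L : latticeType d) (I : set L) : Prop :=
  [/\ I !=set0,
      forall a b, I b -> (a <= b)%O -> I a
    & forall a b, I a -> I b -> I (a `|` b)%O].

Definition bornology (L : tbLatticeType d) (B : set L) : Prop :=
  lattice_ideal B /\ isLub B (\top%O : L).

Definition lattice_filter (L : latticeType d) (F : set L) : Prop :=
  [/\ F !=set0,
      forall a b, F a -> (a <= b)%O -> F b
    & forall a b, F a -> F b -> F (a `&` b)%O].

Definition prime_filter (L : latticeType d) (F : set L) : Prop :=
  [/\ lattice_filter F, F <> setT
    & forall a b, F (a `|` b)%O -> F a \/ F b].

Definition PF (L : latticeType d) : set (set L) := [set F | prime_filter F].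

Definition tilde (L : latticeType d) (a : L) : set (set L) :=
  [set F | PF F /\ F a].

Definition tildes (L : latticeType d) (A : set L) : set (set (set L)) :=
  [set tilde a | a in A].
End Lattices.
Arguments PF {d} L.

Definition CO (X : topologicalType) : set (set X) :=
  [set A | compact A /\ open A].
Arguments CO : clear implicits.

Definition sober (X : topologicalType) : Prop :=
  forall W : set X, open W -> W <> setT ->
    (exists V1 V2 : set X,
       [/\ open V1, open V2, W = V1 `&` V2, W <> V1 & W <> V2]) \/
    (exists x : X, W = ~` closure [set x]).

Record spectral_space := SpectralSpace {
  spectral_carrier :> topologicalType;
  spectral_T0 : kolmogorov_space spectral_carrier;
  spectral_sober : sober spectral_carrier;
  spectral_COT : CO spectral_carrier setT;
  spectral_basis : basis (CO spectral_carrier);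
  spectral_COI : forall A B, CO spectral_carrier A -> CO spectral_carrier B ->
    CO spectral_carrier (A `&` B)
}.

(** The bounded lattice [CO X], as a sublattice of the lattice of sets. *)
Definition co_lattice (X : spectral_space) : Type := set_type (CO X).

Section COLattice.
Variable X : spectral_space.

Fact co_meet_closed : {in CO X &, forall A B, (A `&` B)%O \in CO X}.
Proof.
by move=> A B /set_mem XA /set_mem XB; apply/mem_set; exact: spectral_COI.
Qed.

Fact co_join_closed : {in CO X &, forall A B, (A `|` B)%O \in CO X}.
Proof.
move=> A B /set_mem[cA oA] /set_mem[cB oB]; apply/mem_set.
by split; [exact: compactU|exact: openU].
Qed.

Fact co_bottom : (\bot%O : set X) \in CO X.
Proof. by apply/mem_set; split; [exact: compact0|exact: open0]. Qed.

Fact co_top : (\top%O : set X) \in CO X.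
Proof. by apply/mem_set; exact: spectral_COT. Qed.

HB.instance Definition _ := SubChoice.copy (co_lattice X) (set_type (CO X)).
HB.instance Definition _ :=
  Order.SubChoice_isTBSubLattice.Build set_display (set X) (mem (CO X))
    set_display (co_lattice X)
    co_meet_closed co_join_closed co_bottom co_top.
End COLattice.

Definition spectral (X Y : topologicalType) (g : X -> Y) : Prop :=
  forall B, CO Y B -> CO X (g @^-1` B).

Definition co_family (X : spectral_space) (B : set (co_lattice X)) :
    set (set X) :=
  [set val A | A in B].

Definition co_trace (X : spectral_space) (Z : set X) (A : co_lattice X) :
    set X :=
  val A `&` Z.

(** [f] is an isomorphism of lattices from [L] onto the family [K], whose
    lattice operations are union and intersection of sets. *)
Definition lattice_iso_onto (d : Order.disp_t) (L : latticeType d) (T : Type)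
    (f : L -> set T) (K : set (set T)) : Prop :=
  [/\ set_bij setT K f, Order.meet_morphism f & Order.join_morphism f].

Record specbd := SpecBDObject {
  specbd_space :> spectral_space;
  cos : set (co_lattice specbd_space);
  lump : set specbd_space;
  cos_bornology : bornology cos;
  lump_sub : lump `<=` \bigcup_(A in co_family cos) A;
  lump_iso :
    lattice_iso_onto (co_trace lump) (trace_family (CO specbd_space) lump);
  lump_o : trace_family (CO specbd_space) lump =
    family_o lump (trace_family (co_family cos) lump)
}.
Arguments cos : clear implicits.
Arguments lump : clear implicits.

Definition specbd_morphism (X Y : specbd) (g : X -> Y) : Prop :=
  [/\ spectral g,
      forall A, co_family (cos X) A ->
        exists2 B, co_family (cos Y) B & g @` A `<=` B
    & g @` lump X `<=` lump Y].

Lemma specbd_morphism_id (X : specbd) : specbd_morphism (@idfun X).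
Proof.
split=> [B //|A XA|_ [x Xx <-] //].
by exists A => // _ [x Ax <-].
Qed.

Lemma specbd_morphism_comp (X Y Z : specbd) (g : Y -> Z) (f : X -> Y) :
  specbd_morphism g -> specbd_morphism f -> specbd_morphism (g \o f).
Proof.
move=> [gs gb gl] [fs fb fl]; split=> [C ZC|A XA|_ [x Xx <-]].
- exact: (fs _ (gs _ ZC)).
- have [B YB AB] := fb A XA; have [C ZC BC] := gb B YB.
  exists C => // _ [x Ax <-]; apply: BC; exists (f x) => //.
  by apply: AB; exists x.
- by apply: gl; exists (f x) => //; apply: fl; exists x.
Qed.

Definition SpecBD : category :=
  concrete_category specbd_morphism_id specbd_morphism_comp.

Record latbd := LatBDObject {
  latbd_display : Order.disp_t;
  latbd_lattice :> tbDistrLatticeType latbd_display;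
  lat_small : set latbd_lattice;
  lat_lump : set (set latbd_lattice);
  lat_small_bornology : bornology lat_small;
  lat_lump_sub : lat_lump `<=` \bigcup_(A in tildes lat_small) A
    /\ \bigcup_(A in tildes lat_small) A `<=` PF latbd_lattice;
  lat_lump_sep : forall a b : latbd_lattice,
    a <> b -> tilde a `&` lat_lump <> tilde b `&` lat_lump;
  lat_lump_o : trace_family (tildes [set: latbd_lattice]) lat_lump =
    family_o lat_lump (trace_family (tildes lat_small) lat_lump)
}.
Arguments lat_small : clear implicits.
Arguments lat_lump : clear implicits.

Definition bounded_lattice_hom (d d' : Order.disp_t) (L : tbLatticeType d)
    (M : tbLatticeType d') (h : L -> M) : Prop :=
  [/\ Order.meet_morphism h, Order.join_morphism h,
      h \bot%O = \bot%O & h \top%O = \top%O].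

Definition latbd_morphism (L M : latbd) (h : L -> M) : Prop :=
  [/\ bounded_lattice_hom h,
      forall a, lat_small M a -> exists2 b, lat_small L b & (a `|` h b)%O = h b
    & [set h @^-1` G | G in lat_lump M] `<=` lat_lump L].

Lemma latbd_morphism_id (L : latbd) : latbd_morphism (@idfun L).
Proof.
split=> [//|a La|_ [G LG <-] //].
by exists a => //; exact: joinxx.
Qed.

Lemma latbd_morphism_comp (L M N : latbd) (g : M -> N) (f : L -> M) :
  latbd_morphism g -> latbd_morphism f -> latbd_morphism (g \o f).
Proof.
move=> [[gI gU g0 g1] gs gp] [[fI fU f0 f1] fs fp]; split.
- by split=> [a b|a b||] /=; rewrite ?fI ?gI ?fU ?gU ?f0 ?g0 ?f1 ?g1.
- move=> a Na; have [b Mb ab] := gs a Na; have [c Lc bc] := fs b Mb.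
  by exists c => //=; rewrite -bc gU joinA ab.
- move=> _ [G NG <-]; apply: fp; exists (g @^-1` G) => //.
  by apply: gp; exists G.
Qed.

Definition LatBD : category :=
  concrete_category latbd_morphism_id latbd_morphism_comp.

(* Main.v *)
From HB Require Import structures.
From mathcomp Require Import all_boot all_order all_classical.
From mathcomp Require Import topology.
Require Import Defs.

(** Everything rests on one construction. Let [T] be a set of points together
    with a bounded distributive lattice [L] of subsets of [T], an ideal of
    [small] members of [L] and a set [Z] of [decent] points, such that traces
    on [Z] separate the members of [L] and every subset of [Z] that is locally,
    on small members, a trace of a small member is a trace of a member of [L].
    Sending a point to the prime filter of the members containing it turns such
    data, a [point_rep] of [T], into an object of LatBD ([rep_latbd]), and
    sending a mapping of points to its inverse-image mapping turns the mappings
    that respect the data into morphisms of LatBD in the opposite direction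
    ([pullback_morphism]).

    Both LSS0 and SpecBD are categories of sets with a [point_rep]. A locally
    small space X carries the lattice of the sets that meet every smop in a
    smop, the small members are the smops and all points are decent. An object
    of SpecBD carries its compact open sets, the members of its bornology and
    its decent lump. So inverse image is a functor from each of them to
    LatBD^op, and [concrete_duality] shows that it is an equivalence as soon as
    three things hold. It is faithful because the members separate the points.
    It is full if, for a morphism h and a point x, the inverse image under h of
    the prime filter of x is the prime filter of a point y; then x |-> y is the
    mapping that induces h. For LSS0 this is the condition on lumps in the
    definition of a morphism, since every point is decent. For SpecBD it holds
    because every prime filter of compact open sets of a spectral space comes
    from a point ([spectral_prime_filter]): this is sobriety. Lastly, the
    functor is essentially surjective, because an object (L, L_s, D) of LatBD
    comes from D itself with the traces of L_s as smops ([lss_rep_surj]), and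
    from the prime spectrum of L with D as decent lump ([specbd_rep_surj]). The
    second case needs Stone's theorem that the prime spectrum is spectral with
    compact open sets exactly the sets of prime filters containing a given
    element; it rests on the existence of prime filters avoiding an ideal
    ([prime_filter_avoiding]). *)

Set Implicit Arguments.
Unset Strict Implicit.
Unset Printing Implicit Defensive.

Import Order.Theory.
Local Open Scope classical_set_scope.

(** * Equivalences of categories *)

Lemma equivalent_sym (C D : category) : equivalent C D -> equivalent D C.
Proof. by move=> [F [G [GF FG]]]; exists G, F. Qed.

Lemma isomorphism_comp (C : category) (a b c : C) (g : hom b c) (f : hom a b) :
  isomorphism g -> isomorphism f -> isomorphism (compm g f).
Proof.
move=> [g' [g'g gg']] [f' [f'f ff']]; exists (compm f' g'); split.
  by rewrite compmA -(compmA f') g'g compm1.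
by rewrite compmA -(compmA g) ff' compm1.
Qed.

Lemma isomorphism_fmap (C D : category) (F : functor C D) (a b : C)
  (f : hom a b) : isomorphism f -> isomorphism (fmap F f).
Proof.
by move=> [g [gf fg]]; exists (fmap F g); rewrite -!fmapM gf fg !fmap1.
Qed.

(** One half of the transitivity of equivalence; the other half is the same
    statement with the roles of the functors exchanged. *)
Lemma naturally_isomorphic_conj (C D E : category) (F : functor C D)
    (G : functor D C) (F' : functor D E) (G' : functor E D) :
  naturally_isomorphic (compF G F) (idF C) ->
  naturally_isomorphic (compF G' F') (idF D) ->
  naturally_isomorphic (compF (compF G G') (compF F' F)) (idF C).
Proof.
move=> [eta [eta_nat eta_iso]] [eta' [eta'_nat eta'_iso]].
exists (fun a => compm (eta a) (fmap G (eta' (F a)))); split=> [a b f|a].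
  have /= nat1 := eta_nat _ _ f.
  have /= nat2 := eta'_nat _ _ (fmap F f).
  by rewrite /= -compmA -fmapM nat2 fmapM compmA nat1 compmA.
apply: isomorphism_comp (eta_iso a) _.
exact: (isomorphism_fmap G (eta'_iso (F a))).
Qed.

Lemma equivalent_trans (C D E : category) :
  equivalent C D -> equivalent D E -> equivalent C E.
Proof.
move=> [F [G [GF FG]]] [F' [G' [GF' FG']]]; exists (compF F' F), (compF G G').
by split; apply: naturally_isomorphic_conj.
Qed.

(** The inverse functor chooses preimages of objects and of morphisms, up to the
    isomorphisms [eps]; faithfulness reduces its laws to equations in [D]. *)
Section FullyFaithful.
Variables (C D : category) (F : functor C D).
Hypothesis F_faithful : forall a b : C, injective (@fmap C D F a b).
Hypothesis F_full : forall (a b : C) (g : hom (F a) (F b)),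
  exists f : hom a b, fmap F f = g.
Hypothesis F_surj : forall d : D,
  exists (c : C) (f : hom (F c) d), isomorphism f.

Let G0 (d : D) : C := sval (cid (F_surj d)).
(* The counit of the equivalence, and its inverse. *)
Let eps (d : D) : hom (F (G0 d)) d := sval (cid (svalP (cid (F_surj d)))).
Let eps_iso d : isomorphism (eps d) := svalP (cid (svalP (cid (F_surj d)))).
Let eps' d : hom d (F (G0 d)) := sval (cid (eps_iso d)).

Let eps'K d : compm (eps' d) (eps d) = idm (F (G0 d)).
Proof. by rewrite /eps'; case: cid => ? []. Qed.
Let epsK d : compm (eps d) (eps' d) = idm d.
Proof. by rewrite /eps'; case: cid => ? []. Qed.

Let lift (a b : C) (g : hom (F a) (F b)) : hom a b := sval (cid (F_full g)).
Let liftK (a b : C) (g : hom (F a) (F b)) : fmap F (lift g) = g.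
Proof. exact: svalP (cid (F_full g)). Qed.

Let G1 (d d' : D) (g : hom d d') : hom (G0 d) (G0 d') :=
  lift (compm (eps' d') (compm g (eps d))).

Let G1_1 d : G1 (idm d) = idm (G0 d).
Proof. by apply: F_faithful; rewrite liftK comp1m eps'K fmap1. Qed.

Let G1_M a b c (g : hom b c) (f : hom a b) :
  G1 (compm g f) = compm (G1 g) (G1 f).
Proof.
apply: F_faithful; rewrite fmapM !liftK -[RHS]compmA -(compmA g (eps b)).
by rewrite [compm (eps b) _]compmA epsK comp1m (compmA g f).
Qed.

Let G : functor D C := Functor G1_1 G1_M.

Lemma fully_faithful_equivalent : equivalent C D.
Proof.
exists F, G; split.
  exists (fun a => lift (eps (F a))); split=> [a b f|a] /=.
    by apply: F_faithful; rewrite !fmapM !liftK compmA epsK comp1m.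
  exists (lift (eps' (F a))).
  by split; apply: F_faithful; rewrite fmapM !liftK fmap1 ?epsK ?eps'K.
exists eps; split=> [a b f|]; last exact: eps_iso.
by rewrite /= liftK compmA epsK comp1m.
Qed.
End FullyFaithful.

(** * Families of traces stable under gluing *)

Section Gluing.
Context {d : Order.disp_t} {L : latticeType d}.

(** What the equation between the family of traces and [family_o] says beyond
    the stability of small members under intersection, see
    [trace_o_gluing]. *)
Definition gluing (T : Type) (v : L -> set T) (S : set L) (Z : set T) : Prop :=
  forall M, M `<=` Z ->
    (forall b, S b -> exists2 c, S c & M `&` v b = v c `&` Z) ->
    exists a, M = v a `&` Z.

(** The inclusion from left to right is automatic because [S] is an ideal, so
    the equation in the definitions of SpecBD and LatBD amounts to [gluing],
    which involves a family indexed by the lattice and no family of sets. *)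
Lemma trace_o_gluing (T : Type) (v : L -> set T) (S : set L) (Z : set T) :
  lattice_ideal S -> {morph v : a b / (a `&` b)%O >-> a `&` b} ->
  trace_family (range v) Z = family_o Z (trace_family (v @` S) Z) <->
  gluing v S Z.
Proof.
move=> [_ Sdown _] vI; split=> [E M MZ Mloc|glue].
  have : family_o Z (trace_family (v @` S) Z) M.
    split=> // _ [_ [b Sb <-] <-]; have [c Sc McE] := Mloc b Sb.
    exists (v c); first by exists c.
    by rewrite -McE (setIC (v b)) setIA (setIidl MZ).
  by rewrite -E => -[_ [a _ <-] <-]; exists a.
apply/seteqP; split=> [_ [_ [a _ <-] <-]|M [MZ Mloc]].
  split=> [x []//|_ [_ [b Sb <-] <-]].
  exists (v (a `&` b)%O); last by rewrite vI -setIIl.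
  by exists (a `&` b)%O => //; apply: Sdown Sb _; apply: leIr.
have [|a ->] := glue M MZ; last by exists (v a) => //; exists a.
move=> b Sb; have [|_ [c Sc <-] cE] := Mloc (v b `&` Z).
  by exists (v b) => //; exists b.
by exists c => //; rewrite cE (setIC (v b)) setIA (setIidl MZ).
Qed.

(** Gluing only depends on [Z] and on the traces on it, so it can be moved
    between points and prime filters. *)
Lemma gluing_image (T T' : Type) (p : T -> T') (v : L -> set T)
    (w : L -> set T') (S : set L) (Z : set T) :
  injective p -> (forall a x, Z x -> w a (p x) <-> v a x) ->
  gluing v S Z <-> gluing w S (p @` Z).
Proof.
move=> p_inj pE; split=> glue M MZ Mloc.
  have [||a aE] := glue (p @^-1` M `&` Z); first by move=> x [].
    move=> b Sb; have [c Sc cE] := Mloc b Sb; exists c => //.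
    apply/seteqP; split=> x /= [].
      move=> [Mx Zx] vbx; split=> //; apply/pE => //.
      by have [] : (w c `&` p @` Z) (p x) by rewrite -cE; split=> //; apply/pE.
    move=> vcx Zx; have [Mx wbx] : (M `&` w b) (p x).
      by rewrite cE; split; [apply/pE|exists x].
    by split=> //; apply/pE.
  exists a; apply/seteqP; split=> y.
    move=> My; have [x Zx xy] := MZ y My; split; last by exists x.
    have [vax _] : (v a `&` Z) x by rewrite -aE; split=> //=; rewrite xy.
    by rewrite -xy; apply/pE.
  move=> [wy [x Zx xy]]; have [+ _] : (p @^-1` M `&` Z) x.
    by rewrite aE; split=> //; apply/pE => //; rewrite xy.
  by rewrite /= xy.
have [||a aE] := glue (p @` M); first exact: image_subset.
  move=> b Sb; have [c Sc cE] := Mloc b Sb; exists c => //.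
  apply/seteqP; split=> y [].
    move=> [x Mx <-] /(pE _ _ (MZ _ Mx)) vbx.
    have [vcx Zx] : (v c `&` Z) x by rewrite -cE.
    by split; [apply/pE|exists x].
  move=> + [x Zx xy]; rewrite -xy => /(pE _ _ Zx) vcx.
  have [Mx vbx] : (M `&` v b) x by rewrite cE.
  by split; [exists x|apply/pE].
exists a; apply/seteqP; split=> x.
  move=> Mx; have [] : (w a `&` p @` Z) (p x) by rewrite -aE; exists x.
  by move=> /(pE _ _ (MZ _ Mx)) vax _; split=> //; apply: MZ.
move=> [/(pE _ _ _) wax Zx]; have [x' Mx' /p_inj <- //] : (p @` M) (p x).
by rewrite aE; split; [exact: wax|exists x].
Qed.
End Gluing.

(** * Prime filters *)

Lemma sval_inj (T : Type) (P : T -> Prop) : injective (@sval T P).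
Proof. by move=> [x Px] [y Py] /= xy; apply: eq_exist. Qed.

Section PrimeFilter.
Context {d : Order.disp_t}.

Lemma prime_filter_le (L : latticeType d) (F : set L) (a b : L) :
  PF L F -> (a <= b)%O -> F a -> F b.
Proof. by move=> [[_ up _] _ _] ab Fa; apply: up ab. Qed.

Lemma prime_filterI (L : latticeType d) (F : set L) (a b : L) :
  PF L F -> F (a `&` b)%O <-> F a /\ F b.
Proof.
move=> PF_F; split=> [Fab|[Fa Fb]]; last first.
  by case: PF_F => [[_ _ cap] _ _]; apply: cap.
by split; apply: prime_filter_le PF_F _ Fab; rewrite ?leIl ?leIr.
Qed.

Lemma prime_filterU (L : latticeType d) (F : set L) (a b : L) :
  PF L F -> F (a `|` b)%O <-> F a \/ F b.
Proof.
move=> PF_F; split; first by case: (PF_F) => _ _; apply.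
by move=> []; apply: prime_filter_le PF_F _; rewrite ?leUl ?leUr.
Qed.

Lemma prime_filter0 (L : tbLatticeType d) (F : set L) : PF L F -> ~ F \bot%O.
Proof.
move=> PF_F F0; case: (PF_F) => _ ntriv _; apply: ntriv; apply/seteqP.
by split=> // a _; apply: prime_filter_le PF_F (le0x a) F0.
Qed.

Lemma prime_filter1 (L : tbLatticeType d) (F : set L) : PF L F -> F \top%O.
Proof.
move=> PF_F; case: (PF_F) => [[[a Fa] _ _] _ _].
exact: prime_filter_le PF_F (lex1 a) Fa.
Qed.

Lemma tildeI (L : latticeType d) (a b : L) :
  tilde (a `&` b)%O = tilde a `&` tilde b.
Proof.
apply/seteqP; split=> F.
  by move=> [PF_F /(prime_filterI _ _ PF_F)[Fa Fb]].
by move=> [[PF_F Fa] [_ Fb]]; split=> //; apply/prime_filterI.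
Qed.
End PrimeFilter.

Section PrimeFilterHom.
Context {d d' : Order.disp_t} {L : tbLatticeType d} {M : tbLatticeType d'}.

Lemma prime_filter_preimage (h : L -> M) (F : set M) :
  bounded_lattice_hom h -> PF M F -> PF L (h @^-1` F).
Proof.
move=> [hI hU h0 h1] PF_F; split; first split.
- by exists \top%O; rewrite /= h1; apply: prime_filter1.
- move=> a b Fa /meet_idPl ab; move: Fa; rewrite /= -ab hI.
  by move=> /(prime_filterI _ _ PF_F)[].
- by move=> a b Fa Fb; rewrite /= hI; apply/prime_filterI.
- move=> FT; apply: (prime_filter0 PF_F).
  by rewrite -h0 -[F _]/((h @^-1` F) _) FT.
- by move=> a b; rewrite /= hU; apply: (prime_filterU _ _ PF_F).1.
Qed.
End PrimeFilterHom.

Section PrimeFilterTheorem.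
Context {d : Order.disp_t} {L : tbDistrLatticeType d}.

Lemma principal_ideal (b : L) : lattice_ideal [set a | (a <= b)%O].
Proof.
split=> [|x y /= yb xy|x y /= xb yb]; first by exists b => /=.
  exact: le_trans yb.
by rewrite leUx xb yb.
Qed.

(** An ideal that is maximal among those containing [I] and avoiding [a] is
    prime, so its complement is a prime filter. *)
Lemma prime_filter_avoiding (I : set L) (a : L) :
  lattice_ideal I -> ~ I a ->
  exists2 F, PF L F & F a /\ forall b, I b -> ~ F b.
Proof.
move=> I_ideal Ia.
pose ok J := lattice_ideal (I `|` J) /\ ~ (I `|` J) a.
(* The union of the empty chain is empty, hence the ideals are written as
   [I `|` J] with [J] arbitrary. *)
have [|J [[[[j0 Jj0] down join] Ja] Jmax]] := @Zorn_bigcup L ok.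
  move=> C Cok Ctot; case: I_ideal => [[i0 Ii0] Idown Ijoin]; split; last first.
    by move=> [//|[J CJ Ja]]; have [_] := Cok J CJ; apply; right.
  split; first by exists i0; left.
    move=> x y [Iy|[J CJ Jy]] xy; first by left; apply: Idown xy.
    have [[_ down _] _] := Cok J CJ.
    by have [Ix|Jx] := down x y (or_intror Jy) xy; [left|right; exists J].
  have joinJ J x y : C J -> (I `|` J) x -> (I `|` J) y ->
      (I `|` \bigcup_(K in C) K) (x `|` y)%O.
    move=> CJ Jx Jy; have [[_ _ join] _] := Cok J CJ.
    by have [|] := join x y Jx Jy; [left|right; exists J].
  move=> x y [Ix|[J CJ Jx]] [Iy|[K CK Ky]].
  - by left; apply: Ijoin.
  - by apply: (joinJ K) => //; [left|right].
  - by apply: (joinJ J) => //; [right|left].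
  - have [JK|KJ] := Ctot J K CJ CK.
      by apply: (joinJ K) => //; right => //; apply: JK.
    by apply: (joinJ J) => //; right => //; apply: KJ.
set K := I `|` J in j0 Jj0 down join Ja.
(* By maximality, the ideal generated by [K] and [b] contains [a]. *)
have escape b : ~ K b -> exists2 j, K j & (a <= j `|` b)%O.
  move=> Kb; apply: contrapT => Kab.
  pose N := [set x | exists2 j, K j & (x <= j `|` b)%O].
  have KN : K `<=` N by move=> x Kx; exists x => //; apply: leUl.
  have Nb : N b by exists j0 => //; apply: leUr.
  have IN : I `|` N = N by apply/setUidPr => x Ix; apply: KN; left.
  apply: (Jmax N).
    split=> [x Jx|JN]; first by apply: KN; right.
    by apply: Kb; right; apply: JN.
  rewrite /ok IN; split=> //; split; first by exists b.
    by move=> x y [j Kj yj] xy; exists j => //; apply: le_trans xy yj.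
  move=> x y [j Kj xj] [k Kk yk]; exists (j `|` k)%O; first exact: join.
  rewrite leUx (le_trans xj) ?leU2 ?leUl //=.
  by rewrite (le_trans yk) ?leU2 ?leUr.
exists (~` K); last by split=> // b Ib; apply; left.
split; first split.
- by exists a.
- by move=> x y Kx xy Ky; apply: Kx; apply: down xy.
- (* By distributivity, [a] lies below [j `|` k `|` (x `&` y)]. *)
  move=> x y /escape[j Kj aj] /escape[k Kk ak] Kxy; apply: Ja.
  apply: down (join _ _ (join _ _ Kj Kk) Kxy) _.
  by rewrite joinIr lexI (le_trans aj) ?(le_trans ak) ?leU2 ?leUl ?leUr.
- by move=> KT; have : (~` K) j0 by rewrite KT.
- move=> x y Kxy; apply: contrapT => /not_orP[/contrapT Kx /contrapT Ky].
  by apply: Kxy; apply: join.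
Qed.
End PrimeFilterTheorem.

(** * Sets of points with a lattice of subsets *)

(** The structure common to the objects of LSS0 and of SpecBD. The conditions on
    [decent] are those that make the prime filters of the decent points a
    decent lump of the lattice. *)
Record point_rep (T : Type) := PointRep {
  rep_display : Order.disp_t;
  rep_lattice : tbDistrLatticeType rep_display;
  ext : rep_lattice -> set T;
  ext_hom : bounded_lattice_hom ext;
  small : set rep_lattice;
  small_bornology : bornology small;
  decent : set T;
  decent_sub : decent `<=` \bigcup_(a in small) ext a;
  decent_inj : forall a b, ext a `&` decent = ext b `&` decent -> a = b;
  decent_gluing : gluing ext small decent;
  ext_T0 : forall x y, (forall a, ext a x <-> ext a y) -> x = y
}.

Section PointFilter.
Variables (T : Type) (R : point_rep T).
Implicit Types (a b : rep_lattice R) (x y : T).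

Lemma ext_inj : injective (@ext T R).
Proof. by move=> a b ab; apply: decent_inj; rewrite ab. Qed.

Lemma extI a b : ext (a `&` b)%O = ext a `&` ext b.
Proof. by have [-> _ _ _] := ext_hom R. Qed.

Lemma extU a b : ext (a `|` b)%O = ext a `|` ext b.
Proof. by have [_ -> _ _] := ext_hom R. Qed.

Lemma ext0 : ext (\bot%O : rep_lattice R) = set0.
Proof. by have [_ _ -> _] := ext_hom R. Qed.

Lemma ext1 : ext (\top%O : rep_lattice R) = setT.
Proof. by have [_ _ _ ->] := ext_hom R. Qed.

Lemma ext_le a b : (a <= b)%O <-> ext a `<=` ext b.
Proof.
split=> [/meet_idPl <-|/setIidPl ab]; first by rewrite extI; apply: subIsetr.
by apply/meet_idPl/ext_inj; rewrite extI.
Qed.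

Definition point_filter x : set (rep_lattice R) := [set a | ext a x].

Lemma point_filter_inj : injective point_filter.
Proof.
move=> x y xy; apply: ext_T0 => a.
by change (point_filter x a <-> ext a y); rewrite xy.
Qed.

Lemma point_filter_prime x : PF (rep_lattice R) (point_filter x).
Proof.
split; first split.
- by exists \top%O; rewrite /point_filter /= ext1.
- by move=> a b ax /ext_le; apply.
- by move=> a b ax bx; rewrite /point_filter /= extI.
- move=> xT; have : point_filter x \bot%O by rewrite xT.
  by rewrite /point_filter /= ext0.
- by move=> a b; rewrite /point_filter /= extU.
Qed.

Lemma tilde_point_filter a x : tilde a (point_filter x) <-> ext a x.
Proof. by split=> [[]|ax] //; split=> //; apply: point_filter_prime. Qed.

Let lat_lump_sub_subproof : point_filter @` decent R `<=`
    \bigcup_(A in tildes (@small T R)) A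
  /\ \bigcup_(A in tildes (@small T R)) A `<=` PF (rep_lattice R).
Proof.
split=> [_ [x Zx <-]|F [_ [a _ <-]] []//].
have [a Sa ax] := decent_sub Zx.
by exists (tilde a); [exists a|apply/tilde_point_filter].
Qed.

Let lat_lump_sep_subproof a b : a <> b ->
  tilde a `&` point_filter @` decent R <> tilde b `&` point_filter @` decent R.
Proof.
move=> ab E; apply/ab/decent_inj; apply/seteqP.
suff sub c e : tilde c `&` point_filter @` decent R =
    tilde e `&` point_filter @` decent R ->
    ext c `&` decent R `<=` ext e `&` decent R by split; apply: sub.
move=> {}E x [cx Zx]; split=> //; apply/tilde_point_filter.
suff [] : (tilde e `&` point_filter @` decent R) (point_filter x) by [].
by rewrite -E; split; [apply/tilde_point_filter|exists x].
Qed.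

Let lat_lump_o_subproof :
  trace_family (tildes [set: rep_lattice R]) (point_filter @` decent R) =
  family_o (point_filter @` decent R)
    (trace_family (tildes (@small T R)) (point_filter @` decent R)).
Proof.
apply/trace_o_gluing.
- by have [] := small_bornology R.
- by move=> a b; exact: tildeI.
- have := @decent_gluing T R; apply (gluing_image _ point_filter_inj).
  by move=> a x _; apply: tilde_point_filter.
Qed.

Definition rep_latbd : latbd :=
  LatBDObject (small_bornology R) lat_lump_sub_subproof lat_lump_sep_subproof
    lat_lump_o_subproof.
End PointFilter.
Arguments point_filter {T} R x.

(** * Inverse images as a functor to LatBD *)

(** The inverse image of a member is the extent of a unique member, by
    [ext_inj]; so such a mapping induces a mapping of the lattices. *)
Definition rep_morphism (T T' : Type) (R : point_rep T) (R' : point_rep T')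
    (f : T -> T') : Prop :=
  [/\ forall b, exists a, ext (p := R) a = f @^-1` ext (p := R') b,
      forall a, small (p := R) a ->
        exists2 b, small (p := R') b & ext a `<=` f @^-1` ext b
    & f @` decent R `<=` decent R'].

Section Pullback.
Variables (T T' : Type) (R : point_rep T) (R' : point_rep T') (f : T -> T').

(** The two notions of morphism correspond term by term: the inverse image under
    [h] of the prime filter of x is the prime filter of [f x], so [f] preserves
    decent points exactly when [h] preserves the lumps. *)
Lemma pullback_morphism (h : rep_latbd R' -> rep_latbd R) :
  (forall b, ext (h b) = f @^-1` ext b) ->
  rep_morphism R R' f <-> latbd_morphism h.
Proof.
move=> hE; split=> [[_ f_bd f_dec]|[_ h_bd h_dec]].
  split.
  - by split=> [a b|a b||]; apply: ext_inj;
      rewrite ?hE ?(extI, extU, ext0, ext1) ?hE.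
  - move=> a /f_bd[b Sb ab]; exists b => //.
    by apply/join_idPr/ext_le; rewrite hE.
  - move=> _ [_ [x Zx <-] <-]; exists (f x); first by apply: f_dec; exists x.
    by apply/seteqP; split=> b; rewrite /point_filter /= hE.
split.
- by move=> b; exists (h b).
- move=> a /h_bd[b Sb ab]; exists b => //.
  by rewrite -hE; apply/ext_le/join_idPr.
- move=> _ [x Zx <-].
  have : lat_lump (rep_latbd R') (h @^-1` point_filter R x).
    by apply: h_dec; exists (point_filter R x) => //; exists x.
  have -> : h @^-1` point_filter R x = point_filter R' (f x).
    by apply/seteqP; split=> b; rewrite /point_filter /= hE.
  by move=> [y Zy /(@point_filter_inj _ R') <-].
Qed.
End Pullback.

(** Points that are themselves prime filters of [L]: the identification of [L]
    with the lattice of extents is an isomorphism of LatBD, because [theta]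
    pulls the prime filter of a point [t] back to [e t] and by the last
    hypothesis the decent points give back the lump of [L]. Essential
    surjectivity is obtained from this in both cases. *)
Lemma rep_iso (L : latbd) (T : Type) (R : point_rep T) (e : T -> set L)
    (theta : L -> rep_lattice R) :
  (forall t, PF L (e t)) ->
  (forall a t, ext (theta a) t <-> e t a) ->
  (forall k, exists a, theta a = k) ->
  (forall a, small (theta a) <-> lat_small L a) ->
  e @` decent R = lat_lump L ->
  exists f : @hom (opposite LatBD) (rep_latbd R) L, isomorphism f.
Proof.
move=> ePF thetaE theta_surj theta_small eD.
have theta_inj : injective theta.
  move=> a b ab; apply: contrapT => /lat_lump_sep; apply.
  have sub c c' : theta c = theta c' ->
      tilde c `&` lat_lump L `<=` tilde c' `&` lat_lump L.
    move=> cc' F; rewrite -eD => -[[PF_F Fc] [t Zt tF]].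
    split; last by exists t.
    by split=> //; move: Fc; rewrite -tF => /thetaE; rewrite cc' => /thetaE.
  by apply/seteqP; split; apply: sub.
have thetaI a b : theta (a `&` b)%O = (theta a `&` theta b)%O.
  apply: ext_inj; rewrite extI; apply/seteqP.
  split=> t.
    by move=> /thetaE /(prime_filterI _ _ (ePF t))[? ?]; split; apply/thetaE.
  by move=> [/thetaE ? /thetaE ?]; apply/thetaE/prime_filterI.
have thetaU a b : theta (a `|` b)%O = (theta a `|` theta b)%O.
  apply: ext_inj; rewrite extU; apply/seteqP; split=> t.
    by move=> /thetaE /(prime_filterU _ _ (ePF t))[]?; [left|right];
      apply/thetaE.
  by move=> [] /thetaE ?; apply/thetaE/prime_filterU => //; [left|right].
have theta0 : theta \bot%O = \bot%O.
  have [a aE] := theta_surj \bot%O.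
  by rewrite -[RHS](meetx0 (theta \bot%O)) -aE -thetaI meet0x.
have theta1 : theta \top%O = \top%O.
  have [a aE] := theta_surj \top%O.
  by rewrite -[RHS](joinx1 (theta \top%O)) -aE -thetaU join1x.
have theta_pt t : theta @^-1` point_filter R t = e t.
  by apply/seteqP; split=> a /thetaE.
have theta_mor : @latbd_morphism L (rep_latbd R) theta.
  split=> //.
    move=> k Sk; have [a aE] := theta_surj k; exists a.
      by apply/theta_small; rewrite aE.
    by rewrite aE joinxx.
  by move=> _ [_ [t Zt <-] <-]; rewrite theta_pt -eD; exists t.
have [eta etaK] := choice theta_surj.
have thetaK a : eta (theta a) = a by apply: theta_inj.
have eta_mor : @latbd_morphism (rep_latbd R) L eta.
  split.
  - by split=> [a b|a b||]; apply: theta_inj; rewrite ?(thetaI, thetaU) !etaK.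
  - move=> a Sa; exists (theta a); first exact/theta_small.
    by rewrite thetaK joinxx.
  - move=> _ [F LF <-]; move: LF; rewrite -eD => -[t Zt <-]; exists t => //.
    by apply/seteqP; split=> k; rewrite /= -thetaE etaK.
exists (exist _ theta theta_mor), (exist _ eta eta_mor).
by split; apply: eq_exist; apply/funext => a /=.
Qed.

(** The duality itself, for a category of sets [U X] that carry a [point_rep]
    for which the morphisms are the [rep_morphism]s. *)
Section ConcreteDuality.
Variables (O : Type) (U : O -> Type).
Variable P : forall X Y : O, (U X -> U Y) -> Prop.
Hypothesis P1 : forall X : O, P (@idfun (U X)).
Hypothesis PM : forall (X Y Z : O) (g : U Y -> U Z) (f : U X -> U Y),
  P g -> P f -> P (g \o f).
Variable R : forall X : O, point_rep (U X).
Hypothesis PE : forall (X Y : O) (f : U X -> U Y),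
  P f <-> rep_morphism (R X) (R Y) f.
Hypothesis points_lift :
  forall (X Y : O) (h : rep_latbd (R Y) -> rep_latbd (R X)),
  latbd_morphism h ->
  forall x, exists y, h @^-1` point_filter (R X) x = point_filter (R Y) y.
Hypothesis R_surj : forall L : latbd,
  exists (X : O) (f : @hom (opposite LatBD) (rep_latbd (R X)) L), isomorphism f.

Let C := concrete_category P1 PM.

Let preimage_ex (X Y : O) (f : @hom C X Y) (b : rep_latbd (R Y)) :
  exists a : rep_latbd (R X), ext a = sval f @^-1` ext b.
Proof. by have /PE[+ _ _] := svalP f; apply. Qed.

Let pullback (X Y : O) (f : @hom C X Y) (b : rep_latbd (R Y)) :
  rep_latbd (R X) := sval (cid (preimage_ex f b)).

Let pullbackE (X Y : O) (f : @hom C X Y) (b : rep_latbd (R Y)) :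
  ext (pullback f b) = sval f @^-1` ext b.
Proof. exact: svalP (cid (preimage_ex f b)). Qed.

Let pullback_mor (X Y : O) (f : @hom C X Y) : latbd_morphism (pullback f).
Proof. by apply/(pullback_morphism (pullbackE f))/PE/(svalP f). Qed.

Let D_map (X Y : O) (f : @hom C X Y) :
    @hom (opposite LatBD) (rep_latbd (R X)) (rep_latbd (R Y)) :=
  exist _ (pullback f) (pullback_mor f).

Let D_map1 (X : C) : D_map (idm X) = idm _.
Proof.
by apply: eq_exist; apply/funext => b; apply: ext_inj; rewrite pullbackE.
Qed.

Let D_mapM (X Y Z : C) (g : hom Y Z) (f : hom X Y) :
  D_map (compm g f) = compm (D_map g) (D_map f).
Proof.
by apply: eq_exist; apply/funext => b; apply: ext_inj; rewrite /= !pullbackE.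
Qed.

Let D : functor C (opposite LatBD) := Functor D_map1 D_mapM.

Lemma concrete_duality : equivalent C (opposite LatBD).
Proof.
apply: (@fully_faithful_equivalent _ _ D) => [X Y f g fg|X Y h|//].
  suff : sval f = sval g.
    by case: f g {fg} => f Pf [g Pg] /= fg; apply: eq_exist.
  apply/funext => x; apply: (@ext_T0 _ (R Y)) => b.
  rewrite -[ext b (_ x)]/((sval f @^-1` ext b) x) -pullbackE.
  rewrite -[X in _ <-> X]/((sval g @^-1` ext b) x) -pullbackE.
  by have -> : pullback f = pullback g by case: fg.
have [f fE] := choice (points_lift (svalP h)).
have hE b : ext (sval h b) = f @^-1` ext b.
  suff bE x : ext (sval h b) x <-> ext b (f x) by apply/seteqP; split=> x /bE.
  by change (ext (sval h b) x <-> point_filter (R Y) (f x) b); rewrite -fE.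
have Pf : P f by apply/PE/(pullback_morphism hE)/(svalP h).
exists (exist _ f Pf); case: h hE {fE} => h hmor hE.
rewrite /= /D_map; apply: eq_exist.
by apply/funext => b; apply: ext_inj; rewrite pullbackE hE.
Qed.
End ConcreteDuality.

(** * Locally small spaces *)

Definition locally_smop (X : lss0) : set (set X) := family_o setT (smops X).
Definition lss_lattice (X : lss0) : Type := set_type (@locally_smop X).

Section LssLattice.
Variable X : lss0.

Lemma locally_smop_small A : smops X A -> locally_smop A.
Proof. by move=> XA; split=> // B XB; apply: smopsI. Qed.

Lemma locally_smop_meet :
  {in @locally_smop X &, forall A B, (A `&` B)%O \in @locally_smop X}.
Proof.
move=> A B /set_mem[_ oA] /set_mem[_ oB]; apply/mem_set; split=> // C XC.
by rewrite -setIA; apply/oA/oB.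
Qed.

Lemma locally_smop_join :
  {in @locally_smop X &, forall A B, (A `|` B)%O \in @locally_smop X}.
Proof.
move=> A B /set_mem[_ oA] /set_mem[_ oB]; apply/mem_set; split=> // C XC.
by rewrite setIUl; apply: smopsU; [apply: oA|apply: oB].
Qed.

Lemma locally_smop_bottom : (\bot%O : set X) \in @locally_smop X.
Proof. exact/mem_set/locally_smop_small/smops0. Qed.

Lemma locally_smop_top : (\top%O : set X) \in @locally_smop X.
Proof. by apply/mem_set; split=> // A XA; rewrite setTI. Qed.

HB.instance Definition _ :=
  SubChoice.copy (lss_lattice X) (set_type (@locally_smop X)).
HB.instance Definition _ :=
  Order.SubChoice_isTBSubLattice.Build set_display (set X)
    (mem (@locally_smop X)) set_display (lss_lattice X)
    locally_smop_meet locally_smop_join locally_smop_bottom locally_smop_top.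

Lemma lss_meetUl :
  @left_distributive (lss_lattice X) _ Order.meet Order.join.
Proof. by move=> A B C; apply: val_inj; apply: setIUl. Qed.
HB.instance Definition _ :=
  Order.Lattice_Meet_isDistrLattice.Build set_display (lss_lattice X)
    lss_meetUl.

Definition lss_open (A : set X) (oA : locally_smop A) : lss_lattice X :=
  exist _ A (mem_set oA).

Definition lss_ext : lss_lattice X -> set X := val.

Definition lss_small : set (lss_lattice X) := [set A | smops X (val A)].

Lemma lss_leE (A B : lss_lattice X) : (A <= B)%O <-> val A `<=` val B.
Proof. by split=> [/subsetPset|AB]; last exact/subsetPset. Qed.

(** Smops form an ideal, since a set [B] that meets smops in smops and lies
    below a smop [A] is [B `&` A]; their supremum is the whole space because
    they cover it. *)
Lemma lss_small_bornology : bornology lss_small.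
Proof.
split; first split.
- by exists \bot%O; apply: smops0.
- move=> A B sB /lss_leE/setIidl AB; rewrite /lss_small /= -AB.
  by have [_] := set_mem (valP A); apply.
- by move=> A B sA sB; apply: smopsU.
split=> [A _|B ubB]; first exact: lex1.
apply/lss_leE => x _.
have [A XA Ax] : (\bigcup_(A in smops X) A) x by rewrite smops_cover.
by have /lss_leE := ubB (lss_open (locally_smop_small XA)) XA; apply.
Qed.

Definition lss_rep : point_rep X.
Proof.
refine (@PointRep X set_display (lss_lattice X) lss_ext _ lss_small
  lss_small_bornology setT _ _ _ _).
- by split.
- move=> x _.
  have [A XA Ax] : (\bigcup_(A in smops X) A) x by rewrite smops_cover.
  by exists (lss_open (locally_smop_small XA)).
- by move=> A B; rewrite !setIT; apply: val_inj.
- move=> M _ Mloc; have oM : locally_smop M.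
    split=> // A XA.
    have [B XB] := Mloc (lss_open (locally_smop_small XA)) XA.
    by rewrite setIT /= => ->.
  by exists (lss_open oM); rewrite setIT.
- move=> x y xy; apply: smops_T0 => A XA.
  exact: (xy (lss_open (locally_smop_small XA))).
Defined.
End LssLattice.

(** For a bounded [f], a set [B] that meets smops in smops can be cut down to a
    smop [B `&` B'] before pulling it back to [A], where [B'] contains the image
    of [A]; so continuity extends from smops to the whole lattice. *)
Lemma lss_rep_morphism (X Y : lss0) (f : X -> Y) :
  lss_morphism f <-> rep_morphism (lss_rep X) (lss_rep Y) f.
Proof.
split=> [[f_bd f_ct]|[f_pre f_bd _]].
  split=> [B|A XA|//].
    suff oB : locally_smop (f @^-1` val B) by exists (lss_open oB).
    split=> // A XA; have [B' YB' AB'] := f_bd A XA.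
    have [_ oB] := set_mem (valP B).
    have -> : f @^-1` val B `&` A = f @^-1` (val B `&` B') `&` A.
      apply/seteqP; split=> x /= [Bx Ax]; split=> //; last by case: Bx.
      by split=> //; apply: AB'.
    by apply: f_ct => //; apply: oB.
  have [B YB AB] := f_bd (val A) XA.
  by exists (lss_open (locally_smop_small YB)).
split=> [A XA|B A YB XA].
  have [B YB AB] := f_bd (lss_open (locally_smop_small XA)) XA.
  by exists (val B).
have [A' A'E] := f_pre (lss_open (locally_smop_small YB)).
have [_ oA'] := set_mem (valP A').
by have := oA' A XA; rewrite -[val A']/(ext (p := lss_rep X) A') A'E.
Qed.

(** All points are decent, so the lump of a locally small space consists of the
    prime filters of its points and [h] pulls the lumps back. *)
Lemma lss_points_lift (X Y : lss0)
    (h : rep_latbd (lss_rep Y) -> rep_latbd (lss_rep X)) :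
  latbd_morphism h ->
  forall x, exists y,
    h @^-1` point_filter (lss_rep X) x = point_filter (lss_rep Y) y.
Proof.
move=> [_ _ h_dec] x.
have [|y _ yx] := h_dec (h @^-1` point_filter (lss_rep X) x).
  by exists (point_filter (lss_rep X) x) => //; exists x.
by exists y.
Qed.

(** The members of the lump become points and the traces of small elements
    become smops. By [gluing], the sets that meet every smop in a smop are then
    exactly the traces of elements of [L], so [L] is recovered. *)
Section LssOfLatbd.
Variable L : latbd.

Let T := {F : set L | lat_lump L F}.
Let v (a : L) : set T := [set t | sval t a].

Let lump_prime (t : T) : PF L (sval t).
Proof. by have [+ PF_sub] := lat_lump_sub L => /(_ _ (svalP t)) /PF_sub. Qed.

Let vI a b : v (a `&` b)%O = v a `&` v b.
Proof.
by apply/seteqP; split=> t; apply (prime_filterI _ _ (lump_prime t)).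
Qed.

Let vU a b : v (a `|` b)%O = v a `|` v b.
Proof.
by apply/seteqP; split=> t; apply (prime_filterU _ _ (lump_prime t)).
Qed.

Let v0 : v \bot%O = set0.
Proof. by apply/seteqP; split=> // t; apply: prime_filter0 (lump_prime t). Qed.

Let S := lat_small L.
Let S_ideal : lattice_ideal S.
Proof. by have [] := lat_small_bornology L. Qed.

Let v_small_mem (t : T) : exists2 a, S a & sval t a.
Proof.
have [+ _] := lat_lump_sub L => /(_ _ (svalP t)) [_ [a Sa <-] [_ ta]].
by exists a.
Qed.

Let smops_ : set (set T) := v @` S.

Let smops0_ : smops_ set0.
Proof.
have [[a Sa] down _] := S_ideal.
by rewrite -v0; exists \bot%O => //; apply: down Sa (le0x a).
Qed.

Let smopsI_ A B : smops_ A -> smops_ B -> smops_ (A `&` B).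
Proof.
have [_ down _] := S_ideal.
move=> [a Sa <-] [b Sb <-]; exists (a `&` b)%O => //.
by apply: down Sa _; apply: leIl.
Qed.

Let smopsU_ A B : smops_ A -> smops_ B -> smops_ (A `|` B).
Proof.
have [_ _ join] := S_ideal.
by move=> [a Sa <-] [b Sb <-]; exists (a `|` b)%O => //; apply: join.
Qed.

Let smops_cover_ : \bigcup_(A in smops_) A = setT.
Proof.
apply/seteqP; split=> // t _; have [a Sa ta] := v_small_mem t.
by exists (v a) => //; exists a.
Qed.

(* If [sval s] contains [a] and the small element [b], then it contains the
   small element [a `&` b]; so small elements suffice to separate points. *)
Let smops_T0_ (x y : T) : (forall A, smops_ A -> (A x <-> A y)) -> x = y.
Proof.
move=> xy; have [_ down _] := S_ideal.
have sub (s t : T) : (forall a, S a -> (sval s a -> sval t a)) ->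
    sval s `<=` sval t.
  move=> st a sa; have [b Sb sb] := v_small_mem s.
  apply: prime_filter_le (lump_prime t) (leIl a b) _.
  apply: st; last exact/(prime_filterI _ _ (lump_prime s)).
  by apply: down Sb _; apply: leIr.
apply: sval_inj; apply/seteqP; split; apply: sub => a Sa.
  by have [|+ _] := xy (v a); first by exists a.
by have [|_ +] := xy (v a); first by exists a.
Qed.

Definition lss_of_latbd : lss0 :=
  Lss0 smops0_ smopsI_ smopsU_ smops_cover_ smops_T0_.

Let v_gluing : gluing v S setT.
Proof.
apply/(@gluing_image _ _ _ _ sval v (@tilde _ L) S setT (@sval_inj _ _)).
  by move=> a t _; split=> [[]|ta] //; split=> //; apply: lump_prime.
have -> : sval @` [set: T] = lat_lump L.
  apply/seteqP; split=> [_ [t _ <-]|F LF]; first exact: svalP.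
  by exists (exist _ F LF).
apply/trace_o_gluing; first exact: S_ideal.
- exact: tildeI.
- exact: lat_lump_o.
Qed.

Let v_open a : locally_smop (v a : set lss_of_latbd).
Proof.
have [_ down _] := S_ideal; split=> // _ [b Sb <-].
by rewrite -vI; exists (a `&` b)%O => //; apply: down Sb _; apply: leIr.
Qed.

Lemma lss_rep_surj :
  exists (X : lss0) (f : @hom (opposite LatBD) (rep_latbd (lss_rep X)) L),
    isomorphism f.
Proof.
exists lss_of_latbd.
apply: (@rep_iso L _ (lss_rep lss_of_latbd) sval
  (fun a => lss_open (v_open a))).
- exact: lump_prime.
- by [].
- move=> k; have [//||a aE] := v_gluing (M := val k).
    move=> b Sb; have [_ ok] := set_mem (valP k).
    have [|c Sc cE] := ok (v b); first by exists b.
    by exists c => //; rewrite setIT.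
  by exists a; apply: val_inj; rewrite /= aE setIT.
- move=> a; split=> [[b Sb vba]|Sa]; last by exists a.
  suff -> : a = b by [].
  apply: contrapT => /lat_lump_sep; apply.
  have E (t : T) : sval t a <-> sval t b.
    by change (v a t <-> v b t); rewrite [in X in _ <-> X]vba.
  apply/seteqP; split=> F [[PF_F Fa] LF]; split=> //; split=> //.
    exact: (E (exist _ F LF)).1.
  exact: (E (exist _ F LF)).2.
- apply/seteqP; split=> [_ [t _ <-]|F LF]; first exact: svalP.
  by exists (exist _ F LF).
Qed.
End LssOfLatbd.

Lemma LSS0_LatBD : equivalent LSS0 (opposite LatBD).
Proof.
exact: (concrete_duality lss_morphism_id lss_morphism_comp lss_rep_morphism
  lss_points_lift lss_rep_surj).
Qed.

(** * The prime spectrum of a bounded distributive lattice *)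

(** Compactness in terms of filters, applied to the filter generated by the
    complements of the [U i] in [A]. *)
Lemma compact_directed (X : topologicalType) (I : Type) (P : set I)
    (U : I -> set X) (A : set X) :
  compact A -> P !=set0 -> (forall i, P i -> open (U i)) ->
  (forall i j, P i -> P j -> exists2 k, P k & U i `|` U j `<=` U k) ->
  A `<=` \bigcup_(i in P) U i -> exists2 i, P i & A `<=` U i.
Proof.
move=> cA [i0 Pi0] oU dirU AU; apply: contrapT => noU.
have FF : Filter (filter_from P (fun i => A `\` U i)).
  apply: filter_from_filter; first by exists i0.
  move=> i j Pi Pj; have [k Pk Uk] := dirU i j Pi Pj; exists k => //.
  by move=> x [Ax Ukx]; split; split=> // ?; apply/Ukx/Uk; [left|right].
have PFF : ProperFilter (filter_from P (fun i => A `\` U i)).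
  apply: filter_from_proper => i Pi; apply: contrapT => empty.
  apply: noU; exists i => // x Ax; apply: contrapT => Uix; apply: empty.
  by exists x.
have [|x [Ax clx]] := cA _ PFF; first by exists i0 => // x [].
have [i Pi Uix] := AU x Ax.
have nbhsUi : nbhs x (U i) by apply: open_nbhs_nbhs; split=> //; apply: oU.
have [|y [[_ nUiy] /nUiy//]] := clx (A `\` U i) (U i) _ nbhsUi.
by exists i.
Qed.

Definition spectrum (d : Order.disp_t) (L : tbDistrLatticeType d) : Type :=
  {F : set L | PF L F}.

Section Spectrum.
Context {d : Order.disp_t} {L : tbDistrLatticeType d}.
Implicit Types (a b : L) (t : spectrum L) (V W : set (spectrum L)).

HB.instance Definition _ := gen_eqMixin (spectrum L).
HB.instance Definition _ := gen_choiceMixin (spectrum L).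

Definition points_of a : set (spectrum L) := [set t | sval t a].

Lemma points_of1 : points_of \top%O = setT.
Proof. by apply/seteqP; split=> // t _; apply: prime_filter1 (svalP t). Qed.

Lemma points_of0 : points_of \bot%O = set0.
Proof. by apply/seteqP; split=> // t; apply: prime_filter0 (svalP t). Qed.

Lemma points_ofI a b : points_of (a `&` b)%O = points_of a `&` points_of b.
Proof. by apply/seteqP; split=> t; apply (prime_filterI _ _ (svalP t)). Qed.

Lemma points_ofU a b : points_of (a `|` b)%O = points_of a `|` points_of b.
Proof. by apply/seteqP; split=> t; apply (prime_filterU _ _ (svalP t)). Qed.

(** If [a] is not below [b], some prime filter contains [a] and avoids the
    elements below [b]. *)
Lemma points_of_le a b : points_of a `<=` points_of b <-> (a <= b)%O.
Proof.
split=> [ab|ab t]; last exact: prime_filter_le (svalP t) ab.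
apply/negPn/negP => /negP nab.
have [F PF_F [Fa Fb]] := prime_filter_avoiding (principal_ideal b) nab.
by apply: (Fb b) => /=; [exact: lexx|exact: (ab (exist _ F PF_F) Fa)].
Qed.

Definition spectrum_open : set_system (spectrum L) :=
  [set W | forall t, W t -> exists2 a, points_of a t & points_of a `<=` W].

Lemma spectrum_openT : spectrum_open setT.
Proof. by move=> t _; exists \top%O; rewrite ?points_of1. Qed.

Lemma spectrum_openI : setI_closed spectrum_open.
Proof.
move=> V W oV oW t [/oV[a ta aV] /oW[b tb bW]].
by exists (a `&` b)%O; rewrite points_ofI //; apply: setISS.
Qed.

Lemma spectrum_open_bigcup (I : Type) (f : I -> set (spectrum L)) :
  (forall i, spectrum_open (f i)) -> spectrum_open (\bigcup_i f i).
Proof.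
move=> of_ t [i _ /of_[a ta aW]]; exists a => // s /aW sW.
by exists i.
Qed.

HB.instance Definition _ := isOpenTopological.Build (spectrum L)
  spectrum_openT spectrum_openI spectrum_open_bigcup.

Lemma open_points_of a : open (points_of a).
Proof. by move=> t ta; exists a. Qed.

Lemma nbhs_spectrum t W :
  nbhs t W <-> exists2 a, points_of a t & points_of a `<=` W.
Proof.
split=> [|[a ta aW]]; last first.
  apply: (filterS aW); apply: open_nbhs_nbhs.
  by split=> //; apply: open_points_of.
rewrite nbhsE => -[V [oV Vt] VW]; have [a ta aV] := oV t Vt.
by exists a => //; apply: subset_trans VW.
Qed.

(** Given a filter [G] on [points_of a], the elements whose sets of points have
    complements in [G] form an ideal avoiding [a]; a prime filter that contains
    [a] and avoids this ideal is a cluster point of [G]. *)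
Lemma compact_points_of a : compact (points_of a).
Proof.
move=> G GF Ga; pose I := [set b | G (~` points_of b)].
have I_ideal : lattice_ideal I.
  split=> [|b c Ic bc|b c Ib Ic].
  - by exists \bot%O; rewrite /I /= points_of0 setC0; apply: filterT.
  - by apply: filterS Ic; apply: subsetC; apply/points_of_le.
  - by rewrite /I /= points_ofU setCU; apply: filterI.
have [|F PF_F [Fa Favoid]] := @prime_filter_avoiding _ L I a I_ideal.
  move=> Ia; apply: (@filter_not_empty _ G).
  by rewrite -(setICr (points_of a)); apply: filterI.
exists (exist _ F PF_F); split=> // A V GA /nbhs_spectrum[b Fb bV].
apply: contrapT => empty; apply: Favoid Fb; rewrite /I /=.
by apply: filterS GA => s As bs; apply: empty; exists s; split=> //; apply: bV.
Qed.

Lemma CO_points_of a : CO (spectrum L) (points_of a).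
Proof. by split; [exact: compact_points_of|exact: open_points_of]. Qed.

(** A compact open set is a directed union of sets [points_of a], so it is one
    of them. *)
Lemma CO_spectrum : CO (spectrum L) = range points_of.
Proof.
apply/seteqP; split=> [A [cA oA]|_ [a _ <-]]; last exact: CO_points_of.
have [|||t /oA[a ta aA]|a aA Aa] := compact_directed (U := points_of)
    (P := [set a | points_of a `<=` A]) cA.
- by exists \bot%O; rewrite /= points_of0.
- by move=> a _; apply: open_points_of.
- move=> a b aA bA; exists (a `|` b)%O; last by rewrite points_ofU.
  by rewrite /= points_ofU subUset.
- by exists a.
by exists a => //; apply/seteqP.
Qed.

Lemma spectrum_T0 : kolmogorov_space (spectrum L).
Proof.
move=> s t /eqP st.
have [E|[a [sa|ta]]] : (forall a, sval s a <-> sval t a) \/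
    exists a, (sval s a /\ ~ sval t a) \/ (sval t a /\ ~ sval s a).
- apply: contrapT => /not_orP[nE nD]; apply: nE => a.
  by split=> ha; apply: contrapT => nha; apply: nD; exists a; [left|right].
- by exfalso; apply/st/sval_inj/seteqP; split=> a /E.
- exists (points_of a); left; split; apply/mem_set; last by case: sa.
  by apply: open_nbhs_nbhs; split; [exact: open_points_of|case: sa].
- exists (points_of a); right; split; apply/mem_set; last by case: ta.
  by apply: open_nbhs_nbhs; split; [exact: open_points_of|case: ta].
Qed.

(** If the open set [W] is not an intersection of two larger open sets, then the
    elements whose sets of points are not contained in [W] form a prime filter,
    and [W] is the complement of the closure of this prime filter. *)
Lemma spectrum_sober : sober (spectrum L).
Proof.
move=> W oW WT; apply: contrapT => /not_orP[nodec nocl].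
pose F := [set a | ~ points_of a `<=` W].
have PF_F : PF L F.
  split; first split.
  - exists \top%O => sub1; apply: WT; apply/seteqP; split=> // t _.
    by apply: sub1; rewrite points_of1.
  - move=> a b Fa ab bW; apply: Fa; apply: subset_trans bW.
    exact/points_of_le.
  - move=> a b Fa Fb abW; apply: nodec.
    have oV c : open (W `|` points_of c).
      by apply: openU => //; apply: open_points_of.
    have WV c : F c -> W <> W `|` points_of c.
      by move=> Fc E; apply: Fc; rewrite E; apply: subsetUr.
    exists (W `|` points_of a), (W `|` points_of b).
    split; [exact: oV|exact: oV| |exact: WV|exact: WV].
    by rewrite -setUIr -points_ofI; apply/esym/setUidPl.
  - by move=> FT; have : F \bot%O by [rewrite FT]; apply; rewrite points_of0.
  - move=> a b Fab; apply: contrapT => /not_orP[/contrapT aW /contrapT bW].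
    by apply: Fab; rewrite points_ofU subUset.
apply: nocl; exists (exist _ F PF_F); apply/seteqP; split=> t.
  move=> Wt /(_ W (open_nbhs_nbhs (conj oW Wt)))[_ [-> FW]].
  by have [a Fa aW] := oW _ FW; apply: Fa.
move=> ncl; apply: contrapT => nWt; apply: ncl => V /nbhs_spectrum[a ta aV].
exists (exist _ F PF_F); split=> //; apply: aV => aW.
by apply: nWt; apply: aW.
Qed.

Lemma spectrum_COT : CO (spectrum L) setT.
Proof. by rewrite CO_spectrum; exists \top%O; rewrite ?points_of1. Qed.

Lemma spectrum_basis : basis (CO (spectrum L)).
Proof.
split=> [A []//|t V /nbhs_spectrum[a ta aV]].
by exists (points_of a) => //; split=> //; rewrite CO_spectrum; exists a.
Qed.

Lemma spectrum_COI (A B : set (spectrum L)) :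
  CO (spectrum L) A -> CO (spectrum L) B -> CO (spectrum L) (A `&` B).
Proof.
rewrite !CO_spectrum => -[a _ <-] [b _ <-].
by rewrite -points_ofI; exists (a `&` b)%O.
Qed.

Definition prime_spectrum : spectral_space :=
  SpectralSpace spectrum_T0 spectrum_sober spectrum_COT spectrum_basis
    spectrum_COI.
End Spectrum.
Arguments prime_spectrum {d} L.

(** * Spectral spaces and SpecBD *)

Lemma co_meetUl (X : spectral_space) :
  @left_distributive (co_lattice X) _ Order.meet Order.join.
Proof. by move=> A B C; apply: val_inj; apply: setIUl. Qed.

HB.instance Definition _ (X : spectral_space) :=
  Order.Lattice_Meet_isDistrLattice.Build set_display (co_lattice X)
    (@co_meetUl X).

Section SpectralPoints.
Variable X : spectral_space.

Definition co_elt (A : set X) (COA : CO X A) : co_lattice X :=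
  exist _ A (mem_set COA).

Lemma CO_range : CO X = range (val : co_lattice X -> set X).
Proof.
apply/seteqP; split=> [A COA|_ [A _ <-]]; last exact: set_mem (valP A).
by exists (co_elt COA).
Qed.

Lemma co_leE (A B : co_lattice X) : (A <= B)%O <-> val A `<=` val B.
Proof. by split=> [/subsetPset|AB]; last exact/subsetPset. Qed.

Lemma open_co_sub (V : set X) x : open V -> V x ->
  exists2 A : co_lattice X, val A x & val A `<=` V.
Proof.
move=> oV Vx; have [_ COx] := spectral_basis X.
have [A [COA Ax] AV] := COx x V (open_nbhs_nbhs (conj oV Vx)).
by exists (co_elt COA).
Qed.

Lemma co_separates (x y : X) :
  (forall A : co_lattice X, val A x <-> val A y) -> x = y.
Proof.
move=> xy; apply: contrapT => /eqP /spectral_T0[V].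
have sep s t : nbhs s V -> ~ V t ->
    exists2 A : co_lattice X, val A s & ~ val A t.
  rewrite nbhsE => -[W [oW Ws] WV] nVt; have [A As AW] := open_co_sub oW Ws.
  by exists A => // At; apply/nVt/WV/AW.
move=> [[/set_mem Vx /set_mem nVy]|[/set_mem Vy /set_mem nVx]].
  by have [A Ax nAy] := sep _ _ Vx nVy; apply/nAy/xy.
by have [A Ay nAx] := sep _ _ Vy nVx; apply/nAx/xy.
Qed.

(** Let [W] be the union of the compact open sets outside [F]. By compactness a
    compact open set lies in [W] exactly if it is outside [F], and since [F] is
    closed under intersections, [W] is not an intersection of two larger open
    sets. By sobriety it is the complement of the closure of a point x, and a
    compact open set is not contained in [W] exactly if it contains x. *)
Lemma spectral_prime_filter (F : set (co_lattice X)) :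
  PF (co_lattice X) F -> exists x : X, forall A, F A <-> val A x.
Proof.
move=> PF_F.
pose W := \bigcup_(A in ~` F) val A.
have WE A : F A <-> ~ val A `<=` W.
  split=> [FA AW|nAW]; last first.
    by apply: contrapT => nFA; apply: nAW => x Ax; exists A.
  have [cA _] := set_mem (valP A).
  have [|B _|B C nFB nFC|B nFB AB] := compact_directed (U := val) cA _ _ _ AW.
  - by exists \bot%O; apply: prime_filter0.
  - by have [] := set_mem (valP B).
  - by exists (B `|` C)%O => // /(prime_filterU _ _ PF_F)[].
  - by apply: nFB; apply: prime_filter_le PF_F _ FA; apply/co_leE.
have oW : open W by apply: bigcup_open => A _; have [] := set_mem (valP A).
have WT : W <> setT.
  by move=> WT; apply: (WE _).1 (prime_filter1 PF_F) _; rewrite WT.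
have escape V : open V -> W `<=` V -> W <> V -> exists2 A, F A & val A `<=` V.
  move=> oV WV neq.
  have [x Vx nWx] : exists2 x, V x & ~ W x.
    apply: contrapT => no; apply: neq; apply/seteqP; split=> // x Vx.
    by apply: contrapT => nWx; apply: no; exists x.
  have [A Ax AV] := open_co_sub oV Vx.
  by exists A => //; apply/WE => AW; apply/nWx/AW.
have [[V1 [V2 [oV1 oV2 WV nWV1 nWV2]]]|[x Wx]] := spectral_sober oW WT.
  have [|A FA AV1] := escape V1 oV1 _ nWV1.
    by rewrite WV; apply: subIsetl.
  have [|B FB BV2] := escape V2 oV2 _ nWV2.
    by rewrite WV; apply: subIsetr.
  have /WE[] : F (A `&` B)%O by apply/prime_filterI.
  by rewrite WV; apply: setISS.
exists x => A; split=> [/WE nAW|Ax]; last first.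
  by apply/WE => /(_ x Ax); rewrite Wx; apply; apply: subset_closure.
apply: contrapT => nAx; apply: nAW => y Ay; rewrite Wx => cly.
have [_ oA] := set_mem (valP A).
by have [_ [-> /nAx]] := cly _ (open_nbhs_nbhs (conj oA Ay)).
Qed.
End SpectralPoints.

Section SpecbdRep.
Variable X : specbd.

Definition co_ext : co_lattice X -> set X := val.

Definition specbd_rep : point_rep X.
Proof.
refine (@PointRep X set_display (co_lattice X) co_ext _ (cos X)
  (cos_bornology X) (lump X) _ _ _ _).
- by split.
- by move=> x /lump_sub[_ [A sA <-] Ax]; exists A.
- have [[_ inj _] _ _] := lump_iso X; move=> A B AB.
  by apply: inj AB; apply/mem_set.
- apply/trace_o_gluing => //; first by have [] := cos_bornology X.
  by rewrite -CO_range; apply: lump_o.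
- exact: co_separates.
Defined.
End SpecbdRep.

Lemma specbd_rep_morphism (X Y : specbd) (g : X -> Y) :
  specbd_morphism g <-> rep_morphism (specbd_rep X) (specbd_rep Y) g.
Proof.
split=> [[g_sp g_bd g_dec]|[g_sp g_bd g_dec]]; split=> //.
- move=> B; have COgB := g_sp _ (set_mem (valP B)).
  by exists (co_elt COgB).
- move=> A sA; have [|_ [B sB <-] gAB] := g_bd (val A); first by exists A.
  by exists B => // x Ax; apply: gAB; exists x.
- move=> B COB; have [A AE] := g_sp (co_elt COB).
  rewrite -[g @^-1` B]AE; exact: set_mem (valP A).
- move=> _ [A sA <-]; have [B sB AB] := g_bd A sA.
  by exists (val B); [exists B|move=> _ [x Ax <-]; apply: AB].
Qed.

Lemma specbd_points_lift (X Y : specbd)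
    (h : rep_latbd (specbd_rep Y) -> rep_latbd (specbd_rep X)) :
  latbd_morphism h ->
  forall x, exists y,
    h @^-1` point_filter (specbd_rep X) x = point_filter (specbd_rep Y) y.
Proof.
move=> [h_hom _ _] x.
have [y yE] := spectral_prime_filter
  (prime_filter_preimage h_hom (@point_filter_prime _ (specbd_rep X) x)).
by exists y; apply/seteqP; split=> A /yE.
Qed.

(** By [CO_spectrum] and [points_of_le] the lattice of compact open sets of the
    prime spectrum is [L], so the small elements and the lump can be moved there
    unchanged. *)
Section SpecbdOfLatbd.
Variable L : latbd.

Let X := prime_spectrum L.
Let theta (a : L) : co_lattice X := @co_elt X _ (CO_points_of a).

Let theta_surj (A : co_lattice X) : exists a, theta a = A.
Proof.
have [a _ aA] : range (@points_of _ L) (val A).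
  by rewrite -CO_spectrum; exact: set_mem (valP A).
by exists a; apply: val_inj.
Qed.

Let theta_le a b : (theta a <= theta b)%O <-> (a <= b)%O.
Proof.
split=> [/co_leE ab|ab]; first exact/points_of_le.
by apply/co_leE; apply/points_of_le.
Qed.

Let smallX : set (co_lattice X) := theta @` lat_small L.
Let lumpX : set X := [set t : spectrum L | lat_lump L (sval t)].

Let smallX_bornology : bornology smallX.
Proof.
have [[[a0 Sa0] down join] [_ lub]] := lat_small_bornology L.
split; first split.
- by exists (theta a0), a0.
- move=> A B [b Sb <-]; have [a <-] := theta_surj A => /theta_le ab.
  by exists a => //; apply: down ab.
- move=> _ _ [a Sa <-] [b Sb <-]; exists (a `|` b)%O; first exact: join.
  by apply: val_inj; apply: points_ofU.
split=> [A _|B ubB]; first exact: lex1.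
have [b bB] := theta_surj B.
suff b1 : (\top <= b)%O.
  have theta1 : theta \top%O = \top%O by apply/val_inj/points_of1.
  by rewrite -bB -theta1; apply/theta_le.
by apply: lub => a Sa; apply/theta_le; rewrite bB; apply: ubB; exists a.
Qed.

Let lumpX_sub : lumpX `<=` \bigcup_(A in co_family smallX) A.
Proof.
have [+ _] := lat_lump_sub L => sub t /sub[_ [a Sa <-] [_ ta]].
by exists (points_of a) => //; exists (theta a) => //; exists a.
Qed.

Let sval_lumpX : sval @` lumpX = lat_lump L.
Proof.
apply/seteqP; split=> [_ [t Zt <-]//|F LF].
have [+ PF_sub] := lat_lump_sub L => /(_ _ LF)/PF_sub PF_F.
by exists (exist _ F PF_F).
Qed.

Let tilde_points_of a (t : spectrum L) : tilde a (sval t) <-> points_of a t.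
Proof. by split=> [[]|ta] //; split=> //; apply: svalP t. Qed.

Let lumpX_iso :
  lattice_iso_onto (co_trace lumpX) (trace_family (CO X) lumpX).
Proof.
split; last 2 first.
- by move=> A B; apply: setIIl.
- by move=> A B; apply: setIUl.
split.
- by move=> A _; exists (val A) => //; apply: set_mem (valP A).
- move=> A B _ _; have [a <-] := theta_surj A; have [b <-] := theta_surj B.
  move=> ab; congr theta; apply: contrapT => /lat_lump_sep; apply.
  have sub c e : co_trace lumpX (theta c) = co_trace lumpX (theta e) ->
      tilde c `&` lat_lump L `<=` tilde e `&` lat_lump L.
    move=> ce F [tF LF]; split=> //; move: tF (LF).
    rewrite -sval_lumpX => + [t Zt tF]; rewrite -tF => /tilde_points_of tc.
    apply/tilde_points_of; have [] // : co_trace lumpX (theta e) t.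
    by rewrite -ce.
  by apply/seteqP; split; apply: sub.
- by move=> _ [A COA <-]; exists (co_elt COA).
Qed.

Let lumpX_o :
  trace_family (CO X) lumpX =
    family_o lumpX (trace_family (co_family smallX) lumpX).
Proof.
have S_ideal : lattice_ideal (lat_small L) by have [] := lat_small_bornology L.
have -> : CO X = range (@points_of _ L) by exact: CO_spectrum.
have -> : co_family smallX = @points_of _ L @` lat_small L.
  by rewrite /co_family /smallX image_comp.
apply/trace_o_gluing => //; first by move=> a b; apply: points_ofI.
apply/(@gluing_image _ _ _ _ sval (@points_of _ L) (@tilde _ L) _ lumpX
  (@sval_inj _ _)).
  by move=> a t _; apply: tilde_points_of.
rewrite sval_lumpX; apply/trace_o_gluing => //; first exact: tildeI.
exact: lat_lump_o.
Qed.

Definition specbd_of_latbd : specbd :=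
  SpecBDObject smallX_bornology lumpX_sub lumpX_iso lumpX_o.

Lemma specbd_rep_surj :
  exists (Y : specbd) (f : @hom (opposite LatBD) (rep_latbd (specbd_rep Y)) L),
    isomorphism f.
Proof.
exists specbd_of_latbd.
apply: (@rep_iso L _ (specbd_rep specbd_of_latbd) sval theta) => //.
- exact: svalP.
- move=> a; split=> [[b Sb /(congr1 val)/= ba]|Sa]; last by exists a.
  suff <- : b = a by [].
  by apply/eqP; rewrite eq_le; apply/andP; split; apply/points_of_le;
    rewrite ba.
Qed.
End SpecbdOfLatbd.

Lemma SpecBD_LatBD : equivalent SpecBD (opposite LatBD).
Proof.
exact: (concrete_duality specbd_morphism_id specbd_morphism_comp
  specbd_rep_morphism specbd_points_lift specbd_rep_surj).
Qed.

Theorem theorem5p2 :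
  [/\ equivalent LSS0 (opposite LatBD), equivalent (opposite LatBD) SpecBD
    & equivalent LSS0 SpecBD].
Proof.
have LatBD_SpecBD := equivalent_sym SpecBD_LatBD.
split=> //; first exact: LSS0_LatBD.
exact: equivalent_trans LSS0_LatBD LatBD_SpecBD.
Qed.
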